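(* For the star $S_n$ on $n$ vertices, we have $c_k(S_n)=n-1$ for every $k\geq 3$.
   Context: All graphs are simple. The star $S_n$ has $n$ vertices, and hence $n-1$ edges. Let $G$ be a graph and $k\in\{2,3,\dots\}$. A multiset $\mathscr{P}$ of paths in $G$ is a $k$-rainbow separating path system ($k$-RSPS) if its elements can be colored with $k$ colors so that for every pair of distinct edges $e_1,e_2\in E(G)$ there exist paths $P_1,P_2\in\mathscr{P}$ of distinct colors such that $P_1$ contains $e_1$ but not $e_2$, and $P_2$ contains $e_2$ but not $e_1$. The $k$-rainbow separation number $c_k(G)$ is the smallest cardinality of a $k$-RSPS of $G$.
   Formalization: The case n = 2 is excluded: S_2 has a single edge, so the separation condition is vacuous, the empty multiset is a k-RSPS, and c_k(S_2) = 0 rather than n − 1 = 1. *)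

(* Defs.v *)
From HB Require Import structures.
From mathcomp Require Import all_boot.

Set Implicit Arguments.
Unset Strict Implicit.
Unset Printing Implicit Defensive.

Record sgraph (V : finType) := SGraph {
  adj :> rel V;
  adj_sym : symmetric adj;
  adj_irr : irreflexive adj
}.

Section RainbowSeparation.
Variables (V : finType) (G : sgraph V).

Definition edges : {set {set V}} :=
  [set e | [exists x, exists y, G x y && (e == [set x; y])]].

(* A path is given by its nonempty sequence of distinct vertices, in order.
   The one-vertex path is allowed.  A sequence and its reverse describe the
   same path and have the same edges. *)
Definition is_path (p : seq V) : bool :=
  if p is x :: s then path G x s && uniq p else false.

Definition path_edges (p : seq V) : seq {set V} :=
  [seq [set u.1; u.2] | u <- zip p (behead p)].

(* A multiset of paths is a sequence listing its elements with multiplicity.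
   The colour is attached to the position in that sequence, so that two copies
   of one path may get different colours.  The colouring need not use all k
   colours. *)
Definition is_rsps (k : nat) (P : seq (seq V)) : Prop :=
  {in P, forall p, is_path p} /\
  exists col : 'I_(size P) -> 'I_k,
    forall e1 e2 : {set V}, e1 \in edges -> e2 \in edges -> e1 <> e2 ->
    exists i j : 'I_(size P),
      let P1 := path_edges (tnth (in_tuple P) i) in
      let P2 := path_edges (tnth (in_tuple P) j) in
      [/\ col i <> col j,
          e1 \in P1 /\ e2 \notin P1
        & e2 \in P2 /\ e1 \notin P2].

(* c_k(G) = c.  For k >= 2 a k-RSPS always exists (take every edge twice, in
   two colours), so there is exactly one such c. *)
Definition rainbow_separation_number (k c : nat) : Prop :=
  (exists2 P : seq (seq V), is_rsps k P & size P = c) /\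
  (forall P : seq (seq V), is_rsps k P -> c <= size P).

End RainbowSeparation.

(* The star with centre 0: exactly one endpoint of every edge is 0. *)
Definition star_rel (n : nat) : rel 'I_n :=
  fun x y => (val x == 0) (+) (val y == 0).

Lemma star_sym n : symmetric (@star_rel n).
Proof. by move=> x y; rewrite /star_rel addbC. Qed.

Lemma star_irr n : irreflexive (@star_rel n).
Proof. by move=> x; rewrite /star_rel addbb. Qed.

Definition star (n : nat) : sgraph 'I_n := SGraph (@star_sym n) (@star_irr n).

(* Main.v *)
Require Import Defs.
From mathcomp Require Import all_boot.
From mathcomp Require Import zify.

Set Implicit Arguments.
Unset Strict Implicit.
Unset Printing Implicit Defensive.

(** A path in a star has at most two edges, so a path system is a family of
    sets of size at most two on the [m = n - 1] edges of the star.

    Lower bound ([separating_family_card]).  Let every set of the family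
    distribute a charge of 1 equally among its elements.  An edge lying alone
    in one of the sets receives 1 from it; any other edge [e] lies in some pair
    [{e, e'}], and the set that separates [e] from [e'] is a second set through
    [e], so that [e] receives at least twice 1/2.  Hence there are at least as
    many sets as edges.  The argument needs each edge to lie in some set, which
    separation forces unless there is exactly one edge.

    Upper bound ([rotation_separates]).  Split the [m] edges into blocks of
    three consecutive ones, leaving a last block of at most two.  On each full
    block put the three pairs of the triangle, on the last block the
    singletons, and give the [i]-th set the colour [i] modulo 3.  Every edge of
    a full block sees two colours and two such edges can always choose
    different ones; inside a full block the two edges [a] and [b] are separated
    by the pairs through the third edge; the edges of the last block have
    different colours, and each of them leaves a choice to any edge of a full
    block. *)

(** * Separating families of small sets *)

(** The charges of the discharging argument are doubled to remain integers: a
    set of size 1 or 2 gives [3 - size] to each of its elements, which is 2 in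
    total in both cases. *)
Lemma separating_family_card (I T : finType) (A : {set T}) (S : I -> {set T}) :
    #|A| != 1 -> (forall i, #|S i| <= 2) ->
    {in A &, forall x y, x != y -> exists2 i, x \in S i & y \notin S i} ->
  #|A| <= #|I|.
Proof.
move=> cardA_neq1 cardS sepS.
pose B i := S i :&: A.
have cardB i : #|B i| <= 2.
  by apply: leq_trans (cardS i); rewrite subset_leq_card ?subsetIl.
pose charge x i := (x \in B i) * (3 - #|B i|).
have charge_gt0 x i : x \in B i -> 0 < charge x i.
  by rewrite /charge => ->; have := cardB i; lia.
have given i : \sum_(x in A) charge x i <= 2.
  have -> : \sum_(x in A) charge x i = #|B i| * (3 - #|B i|).
    rewrite -big_distrl /=; congr (_ * _).
    rewrite -sum1_card [LHS]big_mkcond [RHS]big_mkcond /=; apply: eq_bigr => x _.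
    by rewrite /B inE; case: (x \in S i); case: (x \in A).
  by case: #|B i| (cardB i) => [|[|[|]]].
have received x : x \in A -> 2 <= \sum_i charge x i.
  move=> xA.
  have [y yA yNx] : exists2 y, y \in A & x != y.
    have : 0 < #|A :\ x|.
      have := cardsD1 x A; rewrite xA; move: cardA_neq1; lia.
    by case/card_gt0P=> y; rewrite !inE => /andP[yx yA]; exists y; rewrite // eq_sym.
  have [i xSi _] := sepS x y xA yA yNx.
  have xBi : x \in B i by rewrite inE xSi.
  have [Bi1 | Bi_neq1] := eqVneq #|B i| 1.
    by rewrite (bigD1 i) //= {1}/charge xBi Bi1 leq_addr.
  have : 0 < #|B i :\ x| by have := cardsD1 x (B i); rewrite xBi; lia.
  case/card_gt0P=> z; rewrite !inE => /and3P[zx zSi zA].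
  rewrite eq_sym in zx.
  have [j xSj zNSj] := sepS x z xA zA zx.
  have ji : j != i by apply: contraNneq zNSj => ->.
  have xBj : x \in B j by rewrite inE xSj.
  rewrite (bigD1 i) //= (bigD1 j) //= addnA; apply: leq_trans (leq_addr _ _).
  by apply: (@leq_add 1 1); apply: charge_gt0.
rewrite -(leq_pmul2r (isT : 0 < 2)) -!sum_nat_const.
apply: leq_trans (leq_sum _ _) _; first exact: received.
by rewrite exchange_big /=; apply: leq_sum => i _; apply: given.
Qed.

(** * Three-coloured pairs and singletons *)

(** The fixed points are the elements of the incomplete last block: this makes
    [{i, rotation m i}] a singleton there and an edge of the triangle
    elsewhere. *)
Definition rotation (m i : nat) : nat :=
  if i < m %/ 3 * 3 then if i %% 3 == 2 then i - 2 else i.+1 else i.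

Lemma rotation_lt m i : i < m -> rotation m i < m.
Proof. by rewrite /rotation; do 2?[case: ifP]; lia. Qed.

Definition rotation_set (m i : nat) : pred nat := pred2 i (rotation m i).

Lemma rotation_separates m a b : a < m -> b < m -> a <> b ->
  exists i j, [/\ [/\ i < m, j < m & i %% 3 <> j %% 3],
    a \in rotation_set m i /\ b \notin rotation_set m i
    & b \in rotation_set m j /\ a \notin rotation_set m j].
Proof.
move=> am bm ab; set r := rotation m.
pose full x := x < m %/ 3 * 3.
(* The pair starting at [r b] is the one of its block that misses [b].  When
   [a] and [b] have the same residue in different blocks, at least one of them,
   say [b], is in a full block; the second pair through [b], which starts at
   [r (r b)], then has another colour than the set of [a]. *)
pose ij := if a %/ 3 == b %/ 3 then if full a then (r b, r a) else (a, b)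
           else if a %% 3 != b %% 3 then (a, b)
           else if full b then (a, r (r b)) else (r (r a), b).
exists ij.1, ij.2; rewrite !inE /ij /r /rotation /full.
repeat (case: ifP => /=; try lia).
all: by move=> *; do 2!split; lia.
Qed.

(** * Edges and paths of a star *)

Definition spoke m (v : 'I_m) : {set 'I_m.+1} := [set ord0; lift ord0 v].

Lemma spoke_inj m : injective (@spoke m).
Proof.
move=> u v /setP/(_ (lift ord0 u)); rewrite !inE eqxx orbT.
by move=> /esym/eqP/lift_inj.
Qed.

Lemma edges_star m : edges (star m.+1) = [set spoke v | v : 'I_m].
Proof.
apply/setP=> e; rewrite inE; apply/existsP/imsetP.
  case=> x /existsP[y /andP[]] /=; rewrite /star_rel /=.
  case: (unliftP ord0 x) => [u|] ->; case: (unliftP ord0 y) => [v|] -> //= _ /eqP->.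
    by exists u; rewrite // /spoke setUC.
  by exists v.
case=> v _ ->; exists ord0; apply/existsP; exists (lift ord0 v).
by rewrite /spoke eqxx.
Qed.

Lemma card_edges_star m : #|edges (star m.+1)| = m.
Proof. by rewrite edges_star card_imset ?card_ord //; apply: spoke_inj. Qed.

(** Every edge of a star contains the centre, and a path visits it only
    once. *)
Lemma size_path_edges_star m (p : seq 'I_m.+1) :
  is_path (star m.+1) p -> size (path_edges p) <= 2.
Proof.
case: p => [|x [|y [|z [|w s]]]] //= /andP[/and4P[+ + + _]].
rewrite /star_rel /= !inE !negb_or -!val_eqE /=.
lia.
Qed.

(** The path whose edge set is [{spoke u, spoke v}], also when [u = v]. *)
Definition spoke_path m (u v : 'I_m) : seq 'I_m.+1 :=
  if u == v then [:: ord0; lift ord0 u]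
  else [:: lift ord0 u; ord0; lift ord0 v].

Lemma spoke_path_is_path m (u v : 'I_m) :
  is_path (star m.+1) (spoke_path u v).
Proof.
rewrite /spoke_path; case: eqP => [//|/eqP uv] /=.
by rewrite !inE !(inj_eq (@lift_inj _ _)) uv.
Qed.

Lemma mem_spoke_path m (u v w : 'I_m) :
  (spoke w \in path_edges (spoke_path u v)) = (w \in pred2 u v).
Proof.
rewrite /spoke_path /path_edges; case: eqP => [<-|_] /=;
  rewrite !inE ?(setUC [set lift _ _] [set ord0]).
  by rewrite orbb (inj_eq (@spoke_inj m)).
by rewrite !(inj_eq (@spoke_inj m)).
Qed.

(** * The rainbow separation number of a star *)

Lemma star_rsps_size m k (P : seq (seq 'I_m.+1)) :
  m != 1 -> is_rsps (star m.+1) k P -> m <= size P.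
Proof.
move=> m_neq1 [pathP [col sepP]].
pose S (i : 'I_(size P)) := [set e in path_edges (tnth (in_tuple P) i)].
rewrite -{1}(card_edges_star m) -[size P]card_ord.
apply: (@separating_family_card _ _ _ S) => [|i|e e' eE e'E /eqP neq].
- by rewrite card_edges_star.
- rewrite cardsE; apply: leq_trans (card_size _) _.
  by apply/size_path_edges_star/pathP; apply: mem_tnth.
- have [i [_ [_ [ei e'i] _]]] := sepP e e' eE e'E neq.
  by exists i; rewrite inE.
Qed.

Lemma star_rsps_exists m k : 3 <= k ->
  exists2 P, is_rsps (star m.+1) k P & size P = m.
Proof.
move=> k_ge3.
pose next (v : 'I_m) := Ordinal (rotation_lt (ltn_ord v)).
pose f v := spoke_path v (next v).
pose P := codom f.
have sizeP : size P = m by rewrite size_codom card_ord.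
exists P => //; split; first by move=> _ /codomP[v ->]; apply: spoke_path_is_path.
have tnthP i : tnth (in_tuple P) i = f (cast_ord sizeP i).
  rewrite (tnth_nth (f (cast_ord sizeP i))) /= (nth_map (cast_ord sizeP i)).
    by congr f; apply: val_inj; rewrite /= nth_enum_ord // (ltn_ord (cast_ord sizeP i)).
  by rewrite -cardE card_ord (ltn_ord (cast_ord sizeP i)).
have ltk i : i %% 3 < k by apply: leq_trans k_ge3; rewrite ltn_mod.
exists (fun i => Ordinal (ltk i)) => e1 e2.
rewrite edges_star => /imsetP[a _ ->] /imsetP[b _ ->] neq.
have ab : val a <> val b by move/val_inj=> eq_ab; apply: neq; rewrite eq_ab.
have [i [j [[im jm ij] sep_i sep_j]]] :=
  rotation_separates (ltn_ord a) (ltn_ord b) ab.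
exists (cast_ord (esym sizeP) (Ordinal im)), (cast_ord (esym sizeP) (Ordinal jm)).
rewrite /= !tnthP !cast_ordKV /f !mem_spoke_path.
by split; first by case.
Qed.

Theorem theorem3p3 (n k : nat) (n_gt0 : 0 < n) (n_neq2 : n <> 2)
    (k_ge3 : 3 <= k) :
  rainbow_separation_number (star n) k (n - 1).
Proof.
case: n n_gt0 n_neq2 => [//|m] _ m_neq; rewrite subn1 /=.
split; first exact: star_rsps_exists.
by move=> P; apply: star_rsps_size; apply/eqP=> m1; rewrite m1 in m_neq.
Qed.
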